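(* Let $G$ be a $2$-tree with a list assignment $L$ such that $|L(v)|=3$ for every $v\in V(G)$. Then there exists a set $\Phi=\{\phi_1,\phi_2,\phi_3,\phi_4,\phi_5,\phi_6\}$ of six $L$-colorings of $G$ such that for each vertex $v\in V(G)$, $\{\phi_1(v),\phi_2(v),\phi_3(v),\phi_4(v),\phi_5(v),\phi_6(v)\}$ is a multiset in which each color from $L(v)$ appears exactly twice. In particular, every $2$-tree $G$ is weighted $\frac13$-flexibly $3$-choosable.
   Context: Graphs are finite and simple. A $k$-tree is a graph that may be constructed by starting with a $k$-clique and then repeatedly adding a vertex of degree $k$ whose neighbors induce a $k$-clique; thus a $2$-tree is obtained from a single edge by repeatedly adding a vertex adjacent to exactly the two endpoints of an existing edge. A list assignment $L$ on $G$ assigns to each vertex $v$ a set $L(v)$ of colors. An $L$-coloring is a proper coloring $\varphi$ of $G$ with $\varphi(v)\in L(v)$ for every $v\in V(G)$. A weighted request on $G$ with list assignment $L$ is a function $w$ assigning a non-negative real number $w(v,c)$ to each pair $(v,c)$ with $v\in V(G)$, $c\in L(v)$. For $\varepsilon>0$, it is $\varepsilon$-satisfiable if there is an $L$-coloring $\varphi$ of $G$ with $\sum_{v\in V(G)} w(v,\varphi(v))\ge \varepsilon\sum_{v\in V(G),\,c\in L(v)} w(v,c)$. $G$ is weighted $\varepsilon$-flexibly $k$-choosable if for every list assignment $L$ with $|L(v)|=k$ for all $v$, every weighted request is $\varepsilon$-satisfiable. *)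

(* Defs.v *)
From HB Require Import structures.
From mathcomp Require Import all_boot all_order all_algebra finmap.
From mathcomp Require Import reals.

Set Implicit Arguments.
Unset Strict Implicit.
Unset Printing Implicit Defensive.

Import Order.TTheory GRing.Theory Num.Theory.

Local Open Scope fset_scope.
Local Open Scope ring_scope.

Record sgraph := SGraph {
  vertex :> finType;
  adj : rel vertex;
  adj_sym : symmetric adj;
  adj_irr : irreflexive adj
}.

Definition nbrs (G : sgraph) (v : G) : {set G} := [set u | adj v u].

Definition is_clique (G : sgraph) (K : {set G}) : Prop :=
  forall u v : G, u \in K -> v \in K -> u != v -> adj u v.

(* [ktree_on k S] says that the subgraph of G induced by S is a k-tree: the
   construction sequence is carried out inside the fixed graph G, and the
   neighbourhood of the added vertex v at the time of its addition is
   [nbrs v :&: S]. *)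
Inductive ktree_on (G : sgraph) (k : nat) : {set G} -> Prop :=
| ktree_base (K : {set G}) :
    #|K| = k -> is_clique K -> ktree_on k K
| ktree_add (S : {set G}) (v : G) :
    ktree_on k S -> v \notin S ->
    #|nbrs v :&: S| = k -> is_clique (nbrs v :&: S) ->
    ktree_on k (v |: S).

Definition is_ktree (k : nat) (G : sgraph) : Prop := ktree_on k [set: G].

Definition is_Lcoloring (G : sgraph) (C : choiceType) (L : G -> {fset C})
    (phi : {ffun G -> C}) : Prop :=
  (forall u v : G, adj u v -> phi u != phi v) /\
  (forall v : G, phi v \in L v).

(* A request is represented by a total function w; only its values at pairs
   (v, c) with c in L v are ever constrained or used. *)
Definition weighted_request (R : realType) (G : sgraph) (C : choiceType)
    (L : G -> {fset C}) (w : G -> C -> R) : Prop :=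
  forall (v : G) (c : C), c \in L v -> 0 <= w v c.

Definition satisfiable (R : realType) (eps : R) (G : sgraph) (C : choiceType)
    (L : G -> {fset C}) (w : G -> C -> R) : Prop :=
  exists phi : {ffun G -> C}, is_Lcoloring L phi /\
    eps * (\sum_(v : G) \sum_(c <- L v) w v c) <= \sum_(v : G) w v (phi v).

Definition weighted_flexibly_choosable (R : realType) (eps : R) (k : nat)
    (G : sgraph) : Prop :=
  forall (C : choiceType) (L : G -> {fset C}),
    (forall v : G, #|` L v| = k) ->
    forall w : G -> C -> R, weighted_request L w -> satisfiable eps L w.

(* Main.v *)
(* Write the six colors given to a vertex v as a column of length 6.  The
   invariant carried through the construction of the 2-tree is that the six
   pairs of colors on each edge are distinct; without it, the extension step can
   fail.  When w is added to an edge uv, these six pairs are six cells of the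
   3 x 3 array L(u) x L(v), two in each row and two in each column.  They have to
   be filled with colors of L(w), each used twice and none repeated in a row or
   column, so that a cell does not receive its own row or column color.  Up to
   renaming, only the coincidences between the three lists matter, so this is a
   finite problem, solved by computation.  The base edge is obtained in the same
   way, from the six off-diagonal cells of L(u) x L(u).  Distinctness of the
   pairs on one edge makes the colorings distinct, and averaging over the six
   colorings gives 1/3-flexibility. *)

Require Import Defs.
From mathcomp Require Import all_boot all_order all_algebra finmap.
From mathcomp Require Import reals.
From mathcomp Require Import zify lra.

(** * Filling six cells of a 3 x 3 array by computation *)

Definition words {T : Type} (s : seq T) (n : nat) : seq (seq T) :=
  iter n (fun ws => [seq a :: w | a <- s, w <- ws]) [:: [::]].

Lemma mem_words {T : eqType} (s w : seq T) (n : nat) :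
  size w = n -> {subset w <= s} -> w \in words s n.
Proof.
elim: n w => [|n IHn] [|a w] //= [sz_w] sub_ws.
apply/allpairsP; exists (a, w); split=> //=; first exact/sub_ws/mem_head.
by apply: IHn => // b bw; apply: sub_ws; rewrite inE bw orbT.
Qed.

Definition grid : seq (nat * nat) :=
  [seq (i, j) | i <- iota 0 3, j <- iota 0 3].

Definition twice_each (s : seq nat) : bool := perm_eq s (iota 0 3 ++ iota 0 3).

(** Masks give each set of cells exactly once, without repetition and in the order of [grid]. *)
Definition arrays : seq (seq (nat * nat)) :=
  [seq E <- [seq mask m grid | m <- words [:: true; false] 9] |
     twice_each (unzip1 E) && twice_each (unzip2 E)].

Definition fillings (E : seq (nat * nat)) : seq (seq nat) :=
  [seq c <- words (iota 0 3) 6 | [&& twice_each c,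
     uniq (zip (unzip1 E) c) & uniq (zip (unzip2 E) c)]].

(* A label records the position in a third list of each of three distinct
   colors, 3 standing for a color that is absent from that list. *)
Definition labels : seq (seq nat) :=
  [seq p <- words (iota 0 4) 3 | uniq [seq k <- p | k < 3]].

(** Only a color of the third list shared by row and column is excluded; whether two colors labelled
    3 coincide has no effect on the filling. *)
Definition compatible (p q : seq nat) (e : nat * nat) : bool :=
  (nth 3 p e.1 == 3) || (nth 3 p e.1 != nth 3 q e.2).

Definition allowed (p q : seq nat) (e : nat * nat * nat) : bool :=
  (nth 3 p e.1.1 != e.2) && (nth 3 q e.1.2 != e.2).

Lemma allowed_filling (E : seq (nat * nat)) (p q : seq nat) :
  E \in arrays -> p \in labels -> q \in labels -> all (compatible p q) E ->
  exists2 c, c \in fillings E & all (allowed p q) (zip E c).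
Proof.
(* Exhaustive check; [cs] is bound outside the loops over labels, so the fillings of each array are
   enumerated once. *)
have: all (fun E => let cs := [seq zip E c | c <- fillings E] in
    all (fun p => all (fun q => all (compatible p q) E ==>
      has (all (allowed p q)) cs) labels) labels) arrays.
  by vm_compute.
move=> /allP chk /chk /allP chkE /chkE /allP chkp /chkp /implyP has_c /has_c.
by case/hasP=> _ /mapP[c cE ->] ok; exists c.
Qed.

(** * From cells back to columns of colors *)

Definition compat {C : eqType} (s t : seq C) : bool :=
  uniq (zip s t) && all (fun e => e.1 != e.2) (zip s t).

Lemma compatC {C : eqType} (s t : seq C) : compat s t = compat t s.
Proof.
have swapE : zip s t = [seq (e.2, e.1) | e <- zip t s].
  by elim: s t => [|a s IHs] [|b t] //=; rewrite IHs.
rewrite /compat swapE map_inj_uniq => [|[a b] [a' b'] [-> ->] //].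
by rewrite all_map; congr (_ && _); apply: eq_all => e /=; rewrite eq_sym.
Qed.

Lemma map_index {C : eqType} (x : seq C) :
  uniq x -> [seq index a x | a <- x] = iota 0 (size x).
Proof.
case: x => // a0 x ux; apply: (@eq_from_nth _ 0); rewrite size_map ?size_iota //.
by move=> i ltix; rewrite (nth_map a0) // index_uniq // nth_iota.
Qed.

(** On a color absent from [z], [index] returns the size of [z], which is the label 3; on the colors
    of [z] it is injective, so smaller labels do not repeat. *)
Lemma index_label {C : eqType} (x z : seq C) :
  uniq x -> size x = 3 -> size z = 3 -> [seq index a z | a <- x] \in labels.
Proof.
move=> ux sx sz; rewrite mem_filter filter_map map_inj_in_uniq ?filter_uniq //.
  apply: mem_words; rewrite ?size_map // => _ /mapP[a _ ->].
  by rewrite mem_iota ltnS -sz index_size.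
move=> a b; rewrite !mem_filter /= -sz !index_mem => /andP[az _] /andP[bz _].
exact: (index_inj a).
Qed.

Lemma nth_index_label {C : eqType} (x z : seq C) (a : C) :
  a \in x -> nth 3 [seq index b z | b <- x] (index a x) = index a z.
Proof. by move=> ax; rewrite (nth_map a) ?index_mem // nth_index. Qed.

Lemma extend_columns {C : eqType} (x y z s t : seq C) :
  uniq x -> uniq y -> uniq z -> size x = 3 -> size y = 3 -> size z = 3 ->
  perm_eq s (x ++ x) -> perm_eq t (y ++ y) -> compat s t ->
  exists r, [/\ perm_eq r (z ++ z), compat s r & compat t r].
Proof.
move=> ux uy uz sx sy sz; pose P := zip s t.
have [z0] : exists z0 : C, True by case: z sz {uz} => // z0; exists z0.
move=> _ px py; have szst : size s = size t.
  by rewrite (perm_size px) (perm_size py) !size_cat sx sy.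
have def_s : s = unzip1 P by rewrite unzip1_zip ?szst.
have def_t : t = unzip2 P by rewrite unzip2_zip ?szst.
rewrite /compat -/P => /andP[uP /allP neP].
have Px e : e \in P -> e.1 \in x.
  move=> eP; have := map_f fst eP.
  by rewrite -/(unzip1 P) -def_s (perm_mem px) mem_cat orbb.
have Py e : e \in P -> e.2 \in y.
  move=> eP; have := map_f snd eP.
  by rewrite -/(unzip2 P) -def_t (perm_mem py) mem_cat orbb.
pose coord (e : C * C) := (index e.1 x, index e.2 y).
(* Listing the coordinates in the order of [grid] makes [D] literally a member of [arrays]. *)
pose D := [seq d <- grid | d \in map coord P].
have coord_inj : {in P &, injective coord}.
  move=> [a b] [a' b'] /[dup] /Px /= ax /Py /= by_ /[dup] /Px /= ax' /Py /= by_'.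
  by case=> /(index_inj a ax ax') -> /(index_inj b by_ by_') ->.
have pD : perm_eq D (map coord P).
  apply: uniq_perm; rewrite ?filter_uniq // ?map_inj_in_uniq // => d.
  rewrite mem_filter andb_idr // => /mapP[e eP ->].
  apply: allpairs_f; rewrite mem_iota /= add0n.
    by rewrite -[ltnRHS]sx index_mem Px.
  by rewrite -[ltnRHS]sy index_mem Py.
have D1 : perm_eq (unzip1 D) (iota 0 3 ++ iota 0 3).
  apply: perm_trans (perm_map fst pD) _; rewrite -map_comp.
  rewrite (map_comp (index^~ x) fst) -/(unzip1 P) -def_s -{1 2}sx -map_index //.
  by rewrite -map_cat perm_map.
have D2 : perm_eq (unzip2 D) (iota 0 3 ++ iota 0 3).
  apply: perm_trans (perm_map snd pD) _; rewrite -map_comp.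
  rewrite (map_comp (index^~ y) snd) -/(unzip2 P) -def_t -{1 2}sy -map_index //.
  by rewrite -map_cat perm_map.
have arrD : D \in arrays.
  rewrite mem_filter /twice_each D1 D2 !andTb; apply/mapP.
  exists [seq d \in map coord P | d <- grid]; last exact: filter_mask.
  by apply: mem_words => // b _; case: b.
pose p := [seq index a z | a <- x]; pose q := [seq index a z | a <- y].
have comp : all (compatible p q) D.
  apply/allP=> d; rewrite (perm_mem pD) => /mapP[e eP ->{d}].
  rewrite /compatible !nth_index_label ?Px ?Py //.
  (* In the remaining case the row color lies in [z]; an equal label would make the column color the
     same element of [z], against [neP]. *)
  case: eqP => //= /eqP; rewrite -{1}sz => ne_size.
  have ez : e.1 \in z by rewrite -index_mem ltn_neqAle ne_size index_size.
  apply: contra (neP e eP) => /eqP eq12; apply/eqP.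
  by apply: (index_inj e.1 ez _ eq12); rewrite -index_mem -eq12 index_mem.
have [c] := allowed_filling _ _ _ arrD (index_label x z ux sx sz)
  (index_label y z uy sy sz) comp.
rewrite mem_filter => /andP[/and3P[c2 uc1 uc2] _] /allP ok.
have szc : size c = size D by rewrite (perm_size c2) -(perm_size D1) size_map.
have uD : uniq D by rewrite filter_uniq.
(* Reading the filling as a function of the cell carries it over to [P], whose order may differ from
   that of [D]. *)
pose f d := nth 0 c (index d D).
have fD : map f D = c.
  apply: (@eq_from_nth _ 0); rewrite ?size_map // => i ltiD.
  by rewrite (nth_map (0,0)) // /f index_uniq.
have graphD : [seq (d, f d) | d <- D] = zip D c.
  by rewrite -fD -{2}[D]map_id zip_map.
have lt_f e : e \in P -> f (coord e) < 3.
  move=> eP; have: f (coord e) \in c by rewrite -fD map_f // (perm_mem pD) map_f.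
  by rewrite (perm_mem c2) mem_cat orbb mem_iota.
pose h e := nth z0 z (f (coord e)).
have index_h e : e \in P -> index (h e) z = f (coord e).
  by move=> eP; rewrite /h index_uniq // sz lt_f.
have okP e : e \in P -> (e.1 != h e) && (e.2 != h e).
  move=> eP; have dD : coord e \in D by rewrite (perm_mem pD) map_f.
  have := ok (coord e, f (coord e)); rewrite -graphD map_f // => /(_ isT).
  rewrite /allowed /= !nth_index_label ?Px ?Py // -index_h //.
  case/andP=> n1 n2.
  by rewrite (contraNneq _ n1) ?(contraNneq _ n2) // => ->.
(* Serves rows and columns alike: passing to indices, a repeated pair along [P] would give a
   repeated pair in the filling of [D]. *)
have graph_uniq (g : C * C -> C) (g' : nat * nat -> nat) (v : seq C) :
    (forall e, e \in P -> index (g e) v = g' (coord e)) ->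
    uniq (zip (map g' D) c) -> uniq (zip (map g P) (map h P)).
  move=> gE; rewrite -{1}fD !zip_map => ufD.
  apply: (@map_uniq _ _ (fun ab => (index ab.1 v, index ab.2 z))).
  rewrite -map_comp /comp /=.
  have -> : [seq (index (g e) v, index (h e) z) | e <- P] =
      [seq (g' d, f d) | d <- map coord P].
    by rewrite -map_comp; apply/eq_in_map => e eP /=; rewrite gE ?index_h.
  by rewrite -(perm_uniq (perm_map _ pD)).
exists (map h P); split.
- rewrite -[z](@mkseq_nth _ z0) sz /mkseq -map_cat.
  have -> : map h P = [seq nth z0 z k | k <- map f (map coord P)].
    by rewrite -!map_comp.
  by apply/perm_map/(perm_trans _ c2); rewrite perm_sym -fD perm_map.
- apply/andP; split; first by rewrite def_s (graph_uniq fst fst x).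
  by rewrite def_s zip_map all_map; apply/allP=> e /okP /andP[].
- apply/andP; split; first by rewrite def_t (graph_uniq snd snd y).
  by rewrite def_t zip_map all_map; apply/allP=> e /okP /andP[].
Qed.

Lemma edge_columns {C : eqType} (x y : seq C) :
  uniq x -> uniq y -> size x = 3 -> size y = 3 ->
  exists s t, [/\ perm_eq s (x ++ x), perm_eq t (y ++ y) & compat s t].
Proof.
move=> ux uy sx sy.
have [x0 [x1 [x2 def_x]]] : exists x0 x1 x2, x = [:: x0; x1; x2].
  by case: x sx {ux} => [|x0 [|x1 [|x2 []]]] // _; exists x0, x1, x2.
(* Read in parallel, [s] and [t] run through the six off-diagonal cells of the array of [x] against
   itself. *)
pose s := [:: x0; x0; x1; x1; x2; x2]; pose t := [:: x1; x2; x0; x2; x0; x1].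
have [ps pt] : perm_eq s (x ++ x) /\ perm_eq t (x ++ x).
  by rewrite def_x; split; apply/permP=> a /=; lia.
have st : compat s t.
  move: ux; rewrite def_x /compat /= !inE !negb_or !xpair_eqE /= andbT.
  rewrite ![x1 == x0]eq_sym ![x2 == x0]eq_sym ![x2 == x1]eq_sym.
  by case/andP=> [/andP[/negPf-> /negPf->] /negPf->]; rewrite !eqxx.
(* A vertex with list [y] is added to an auxiliary edge whose ends both have list [x]; one end is
   then dropped. *)
have [r [pr sr _]] := extend_columns x x y s t ux ux uy sx sx sy ps pt st.
by exists s, r.
Qed.

(** * Columns along the construction of a 2-tree *)

Definition good_columns {G : sgraph} {C : choiceType} (L : G -> {fset C})
    (S : {set G}) (col : G -> seq C) : Prop :=
  (forall v, v \in S -> perm_eq (col v) (L v ++ L v)) /\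
  (forall u v, u \in S -> v \in S -> adj u v -> compat (col u) (col v)).

Lemma clique2P {G : sgraph} (K : {set G}) :
  #|K| = 2 -> is_clique K -> exists u v, K = [set u; v] /\ adj u v.
Proof.
move=> cK clK; have /cards2P[u [v [neq_uv def_K]]] : #|K| == 2 by rewrite cK.
by exists u, v; split=> //; apply: clK; rewrite ?def_K ?set21 ?set22.
Qed.

(** Supplies the edge on which the six colorings are told apart. *)
Lemma ktree2_edge {G : sgraph} (S : {set G}) :
  ktree_on 2 S -> exists u v, [/\ u \in S, v \in S & adj u v].
Proof.
elim=> [K cK clK | S' v _ [a [b [aS bS ab]]] _ _ _].
  have [u [v [-> uv]]] := clique2P K cK clK.
  by exists u, v; rewrite set21 set22.
by exists a, b; rewrite !inE aS bS !orbT.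
Qed.

Lemma ktree2_columns {G : sgraph} {C : choiceType} (L : G -> {fset C})
    (S : {set G}) :
  (forall v, #|` L v|%fset = 3) -> ktree_on 2 S ->
  exists col, good_columns L S col.
Proof.
move=> sL; elim=> {S} [K cK clK | S w _ [col [bal cpt]] wS cN clN].
  have [u [v [-> uv]]] := clique2P K cK clK.
  have neq_vu : v != u by apply: contraTneq uv => ->; rewrite adj_irr.
  have [s [t [ps pt st]]] :=
    edge_columns (L u) (L v) (fset_uniq _) (fset_uniq _) (sL u) (sL v).
  exists (fun a => if a == u then s else t); split=> [a | a b] /set2P[] ->.
  - by rewrite eqxx.
  - by rewrite (negPf neq_vu).
  - case/set2P=> ->; first by rewrite adj_irr.
    by rewrite eqxx (negPf neq_vu).
  - case/set2P=> ->; last by rewrite adj_irr.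
    by rewrite eqxx (negPf neq_vu) compatC.
have [u [v [defN uv]]] := clique2P _ cN clN.
have mem_nbr a : a \in S -> adj w a -> (a == u) || (a == v).
  by move=> aS wa; rewrite -in_set2 -defN !inE wa.
have [uS vS] : u \in S /\ v \in S.
  have [] : u \in nbrs w :&: S /\ v \in nbrs w :&: S.
    by rewrite defN set21 set22.
  by rewrite !inE => /andP[_ ->] /andP[_ ->].
have [r [pr ur vr]] := extend_columns (L u) (L v) (L w) (col u) (col v)
  (fset_uniq _) (fset_uniq _) (fset_uniq _) (sL u) (sL v) (sL w)
  (bal u uS) (bal v vS) (cpt u v uS vS uv).
have r_nbr a : a \in S -> adj w a -> compat (col a) r.
  by move=> aS /(mem_nbr a aS) /orP[] /eqP->.
have neq_w a : a \in S -> (a == w) = false.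
  by move=> aS; apply: contraNF wS => /eqP <-.
(* Old columns are kept: the only new edges join [w] to [u] and [v]. *)
exists (fun a => if a == w then r else col a); split=> [a | a b].
  by case/setU1P=> [-> | aS]; rewrite ?eqxx // neq_w //; apply: bal.
case/setU1P=> [-> | aS] /setU1P[-> | bS]; rewrite ?eqxx ?neq_w //.
- by rewrite adj_irr.
- by move=> wb; rewrite compatC r_nbr.
- by rewrite adj_sym => wa; rewrite r_nbr.
- exact: cpt.
Qed.

(** * Six colorings and flexibility *)

Lemma ktree2_six_colorings {G : sgraph} {C : choiceType} (L : G -> {fset C}) :
  is_ktree 2 G -> (forall v, #|` L v|%fset = 3) ->
  exists phi : 'I_6 -> {ffun G -> C},
    [/\ injective phi, forall i, is_Lcoloring L (phi i)
      & forall v, perm_eq [seq phi i v | i : 'I_6] (L v ++ L v)].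
Proof.
move=> hG sL; have [col [bal cpt]] := ktree2_columns L [set: G] sL hG.
have [u [v [_ _ uv]]] := ktree2_edge [set: G] hG.
have sz a : size (col a) = 6.
  by rewrite (perm_size (bal a (in_setT a))) size_cat [size _]sL.
have /fset0Pn[c0 _] : L u != fset0 by rewrite -cardfs_gt0 sL.
(* Coloring [i] reads entry [i] of every column; all columns have length 6, so the default [c0] is
   never returned. *)
pose phi (i : 'I_6) := [ffun a => nth c0 (col a) i].
have col_phi a : [seq phi i a | i : 'I_6] = col a.
  apply: (@eq_from_nth _ c0); rewrite size_map -cardE card_ord ?sz // => i lti.
  by rewrite (nth_map ord0) -?cardE ?card_ord // ffunE nth_enum_ord.
have nth_phi a b (i : 'I_6) :
    nth (c0, c0) (zip (col a) (col b)) i = (phi i a, phi i b).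
  by rewrite nth_zip ?sz // !ffunE.
have sz_zip a b : size (zip (col a) (col b)) = 6 by rewrite size_zip !sz.
exists phi; split=> [i j eq_ij | i | a]; last by rewrite col_phi bal ?in_setT.
  have /andP[uuv _] := cpt u v (in_setT _) (in_setT _) uv.
  apply/val_inj/eqP; rewrite -(nth_uniq (c0, c0) _ _ uuv) ?sz_zip //=.
  by rewrite !nth_phi eq_ij.
split=> [a b ab | a].
  have /andP[_ /allP neq] := cpt a b (in_setT _) (in_setT _) ab.
  have lti : i < size (zip (col a) (col b)) by rewrite sz_zip.
  by have := neq _ (mem_nth (c0, c0) lti); rewrite nth_phi.
have: phi i a \in L a ++ L a.
  by rewrite -(perm_mem (bal a (in_setT a))) ffunE mem_nth ?sz.
by rewrite mem_cat orbb.
Qed.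

Local Open Scope fset_scope.
Local Open Scope ring_scope.
Import Order.TTheory GRing.Theory Num.Theory.

Theorem theorem3p2 (G : sgraph) (hG : is_ktree 2 G) :
  (forall (C : choiceType) (L : G -> {fset C}),
     (forall v : G, #|` L v| = 3%N) ->
     exists phi : 'I_6 -> {ffun G -> C},
       [/\ injective phi,
           forall i : 'I_6, is_Lcoloring L (phi i)
         & forall (v : G) (c : C), c \in L v ->
             #|[set i : 'I_6 | phi i v == c]| = 2%N]) /\
  (forall R : realType, weighted_flexibly_choosable (3^-1 : R) 3 G).
Proof.
split=> [C L sL | R C L sL w w_ge0].
  have [phi [inj_phi col_phi bal]] := ktree2_six_colorings L hG sL.
  exists phi; split=> // v c cL; have := permP (bal v) (pred1 c).
  rewrite count_map count_cat !count_uniq_mem ?fset_uniq //.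
  by rewrite -[_ \in _]/(c \in L v) cL cardsE cardE size_filter enumT.
have [phi [_ col_phi bal]] := ktree2_six_colorings L hG sL.
set W := \sum_v \sum_(c <- L v) w v c.
have total : \sum_(i < 6) \sum_v w v (phi i v) = W *+ 2.
  rewrite exchange_big -sumrMnl; apply: eq_bigr => v _.
  transitivity (\sum_(c <- [seq phi i v | i : 'I_6]) w v c).
    by rewrite big_image.
  by rewrite (perm_big _ (bal v)) big_cat mulr2n.
(* If all six colorings stayed below [W]/3, they would total less than 2[W], against [total]. *)
have [i le_i | lt_all] := pickP (fun i => 3^-1 * W <= \sum_v w v (phi i v)).
  by exists (phi i).
have : \sum_(i < 6) \sum_v w v (phi i v) < \sum_(i < 6) 3^-1 * W.
  apply: ltr_sum => [|i _].
    by apply/hasP; exists ord0; rewrite ?mem_index_enum.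
  by rewrite ltNge lt_all.
rewrite total sumr_const card_ord; lra.
Qed.
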